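(* Let $G$ be a finite, simple, connected, vertex-transitive $(q+1)$-regular graph with $n$ vertices and $m$ edges, let $a\in[0,1]$ and $b\in\mathbb R$, and set $\eta=(1-q)a+b(q+1)$ and $\sigma=b((1-q)a+bq)$. Then for complex $u$ with $|u|$ sufficiently small (principal branches of logarithms and powers), \[ \zeta_{a,b}(G,u)^{-1}=(1-b^2u^2)^{(q-1)/2}\exp\Big[\frac1n\sum_{\lambda\in\operatorname{Spec}(\mathbf P)}\log\{(1+\sigma u^2)-\eta u\lambda\}\Big] \] and \[ \zeta_{a,b}(G,u)^{-1}=(1-b^2u^2)^{(q-1)/2}\exp\Big[\frac1n\sum_{\lambda\in\operatorname{Spec}(\Delta)}\log\Big\{(1-\eta u+\sigma u^2)+\frac{\eta u}{q+1}\lambda\Big\}\Big], \] where the sums run over the eigenvalues of $\mathbf P=\mathbf P(G)$, respectively of the Laplacian $\Delta=\mathbf D-\mathbf A(G)$, counted with multiplicity.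
   Context: $D(G)$ is the set of $2m$ arcs of $G$ (for each edge $uv$, both $(u,v)$ and $(v,u)$); for $e=(u,v)$, $o(e)=u$, $t(e)=v$, $e^{-1}=(v,u)$. The weight $w:D(G)\times D(G)\to\mathbb C$ is $w(f,e)=(2/\deg t(f)-1)a+b$ if $t(f)=o(e)$ and $f\ne e^{-1}$, $w(f,e)=(2/\deg t(f)-1)a$ if $f=e^{-1}$, and $0$ otherwise. A cycle of length $r$ is a sequence $C=(e_1,\ldots,e_r)$ of arcs with $t(e_i)=o(e_{i+1})$ for $i<r$ and $t(e_r)=o(e_1)$ (backtracking allowed), with $w(C)=w(e_1,e_2)\cdots w(e_{r-1},e_r)w(e_r,e_1)$; it is an $x_0$-cycle if $o(e_1)=x_0$. Fixing a vertex $x_0$, the generalized $(a,b)$-zeta function is $\zeta_{a,b}(G,u)=\exp\big(\sum_{r\ge1}\frac{N^0_r}{r}u^r\big)$ with $N^0_r=\sum\{w(C)\mid C$ an $x_0$-cycle of length $r\}$. $G$ is vertex-transitive if its automorphism group acts transitively on vertices. $\mathbf P(G)$ has entries $P_{uv}=1/\deg u$ if $u,v$ adjacent and $0$ otherwise; $\mathbf D$ is the diagonal degree matrix and $\mathbf A(G)$ the adjacency matrix. *)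

(* Defs.v *)
From HB Require Import structures.
From mathcomp Require Import all_boot all_order all_algebra.
From mathcomp Require Import all_classical all_reals all_analysis.
From mathcomp Require Import complex.
From mathcomp Require Import perm.
Import Order.TTheory GRing.Theory Num.Theory.
Import numFieldNormedType.Exports.

Set Implicit Arguments.
Unset Strict Implicit.
Unset Printing Implicit Defensive.

Local Open Scope ring_scope.

(* The complex numbers over a real type R, viewed as a numFieldType so that
   MathComp-Analysis equips it with its norm topology (limits of series). *)
Definition Cplx (R : realType) : numFieldType := R[i].

Definition expC (R : realType) (z : Cplx R) : Cplx R :=
  let: Complex x y := z in ((expR x)%:C * ((cos y)%:C + 'i * (sin y)%:C))%C.

(* principal argument in (-pi, pi] (atan2) *)
Definition ArgC (R : realType) (z : Cplx R) : R :=
  let: Complex x y := z in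
  if 0 < x then atan (y / x)
  else if x < 0 then (if 0 <= y then atan (y / x) + pi else atan (y / x) - pi)
  else (if 0 < y then pi / 2 else if y < 0 then - (pi / 2) else 0).

Definition modC (R : realType) (z : Cplx R) : R :=
  let: Complex x y := z in Num.sqrt (x ^+ 2 + y ^+ 2).

Definition LogC (R : realType) (z : Cplx R) : Cplx R :=
  ((ln (modC z))%:C + 'i * (ArgC z)%:C)%C.

Definition powC (R : realType) (z w : Cplx R) : Cplx R := expC (w * LogC z).

(* ---------- graphs: a simple graph is a symmetric irreflexive rel on a finType *)

Definition deg (T : finType) (e : rel T) (v : T) : nat := #|[set w | e v w]|.

Definition vertex_transitive (T : finType) (e : rel T) : Prop :=
  forall x y : T, exists f : {perm T}, f x = y /\ forall u v, e (f u) (f v) = e u v.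

Definition arc (T : finType) (e : rel T) := {p : T * T | e p.1 p.2}.

Definition arc_o (T : finType) (e : rel T) (f : arc e) : T := (val f).1.
Definition arc_t (T : finType) (e : rel T) (f : arc e) : T := (val f).2.

Definition weight (R : realType) (T : finType) (e : rel T) (a b : R)
    (f g : arc e) : R :=
  let c := (2 / (deg e (arc_t f))%:R - 1) * a in
  if arc_t f == arc_o g then
    (if arc_o f == arc_t g then c (* f = g^{-1} *) else c + b)
  else 0.

(* cycles of length k.+1: sequences (c_0,...,c_k) of arcs with t(c_i) = o(c_{i+1})
   cyclically (backtracking allowed); x0-cycles start at x0 *)
Definition is_x0_cycle (T : finType) (e : rel T) (x0 : T) (k : nat)
    (c : {ffun 'I_k.+1 -> arc e}) : bool :=
  [forall i, arc_t (c i) == arc_o (c (ordS i))] && (arc_o (c ord0) == x0).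

Definition cycle_weight (R : realType) (T : finType) (e : rel T) (a b : R)
    (k : nat) (c : {ffun 'I_k.+1 -> arc e}) : R :=
  \prod_(i < k.+1) weight a b (c i) (c (ordS i)).

(* N^0_{k+1} *)
Definition N0 (R : realType) (T : finType) (e : rel T) (a b : R) (x0 : T)
    (k : nat) : R :=
  \sum_(c : {ffun 'I_k.+1 -> arc e} | is_x0_cycle x0 c) cycle_weight a b c.

Definition zeta_term (R : realType) (T : finType) (e : rel T) (a b : R) (x0 : T)
    (u : Cplx R) (k : nat) : Cplx R :=
  ((N0 e a b x0 k)%:C)%C / (k.+1)%:R * u ^+ k.+1.

Definition zeta_ab (R : realType) (T : finType) (e : rel T) (a b : R) (x0 : T)
    (u : Cplx R) : Cplx R :=
  expC (limn (series (zeta_term e a b x0 u))).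

Definition Pmat (R : realType) (T : finType) (e : rel T) : 'M[Cplx R]_#|T| :=
  \matrix_(i, j) (if e (enum_val i) (enum_val j)
                  then ((deg e (enum_val i))%:R)^-1 else 0).

Definition Lapl (R : realType) (T : finType) (e : rel T) : 'M[Cplx R]_#|T| :=
  \matrix_(i, j) ((if i == j then (deg e (enum_val i))%:R else 0)
                  - (if e (enum_val i) (enum_val j) then 1 else 0)).

(* Main.v *)
(** Write [B] for the matrix of the weights on arcs, [J] for arc reversal and [n]
    for the number of vertices.

    Weights of non-cycles vanish, so summing the [x]-cycles over all [x] gives the
    trace of [B^r]; by vertex-transitivity [n N0_r = tr B^r = sum mu^r], [mu]
    running over the eigenvalues of [B].  Hence, for small [u], the exponent of
    the zeta function is [- (1/n) sum Log (1 - u mu)].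

    Up to the reversal term, [B] factors through the vertices, and
    [det (c - X Y)] and [det (c - Y X)] agree up to a power of [c].  This yields an
    Ihara-Bass identity for [det (1 - u B)^2]; the square spares us the
    evaluation of [det (1 - u b J)], because conjugating [J] by the signs of an
    orientation gives [- J], whence [det (1 - u b J)^2 = (1 - u^2 b^2)^(2 m)].

    Both sides of the identity are products of factors [1 - O(u)], and for small [u]
    the sums of their principal logarithms have imaginary parts in [(-pi, pi)],
    where the exponential is injective.  The identity can therefore be read
    additively, and dividing by [2 n] gives the two formulas. *)

Require Import Defs.
From HB Require Import structures.
From mathcomp Require Import all_boot all_order all_algebra.
From mathcomp Require Import all_classical all_reals all_analysis.
From mathcomp Require Import complex.
From mathcomp Require Import perm ring lra.
Import Order.TTheory GRing.Theory Num.Theory.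
Import numFieldNormedType.Exports.
Local Open Scope classical_set_scope.
Local Open Scope ring_scope.

Set Implicit Arguments.
Unset Strict Implicit.

(* [path.arc] shadows the type of arcs of a graph. *)
Local Notation arc := Defs.arc.

(** * Determinants and traces *)

(** Two block eliminations of [Y] in [M], one by columns and one by rows, evaluate its determinant.
    Keeping the powers of [c] on both sides avoids any division by [c]. *)
Lemma det_scalar_sub_mulC (F : comNzRingType) p n (X : 'M[F]_(p, n))
    (Y : 'M[F]_(n, p)) (c : F) :
  c ^+ n * \det (c%:M - X *m Y) = c ^+ p * \det (c%:M - Y *m X).
Proof.
pose M := block_mx c%:M X Y (1%:M : 'M[F]_n).
have detM : \det M = \det (c%:M - X *m Y).
  have := det_mulmx M (block_mx 1%:M 0 (- Y) 1%:M).
  rewrite det_lblock !det1 !mulr1 mulmx_block.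
  rewrite !mulmx1 !mulmx0 !mul1mx !mulmxN !add0r addrN det_ublock.
  by rewrite det1 mulr1.
have := det_mulmx (block_mx 1%:M 0 (- Y) c%:M) M.
rewrite det_lblock det1 mul1r det_scalar detM mulmx_block.
rewrite !mulmx1 !mul0mx !mul1mx !addr0 mul_mx_scalar mul_scalar_mx scalerN addNr.
by rewrite mulNmx det_ublock det_scalar addrC => ->.
Qed.

(** For [d != 0] this is [d ^+ n] times the characteristic polynomial at [c / d]. The list of roots
    has length [n], so the power of [d] can be shared out among the factors. *)
Lemma det_scalar_sub_scale (F : fieldType) n (A : 'M[F]_n) (s : seq F) (c d : F) :
  char_poly A = \prod_(l <- s) ('X - l%:P) ->
  \det (c%:M - d *: A) = \prod_(l <- s) (c - d * l).
Proof.
move=> charA.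
have size_s : size s = n.
  by apply: succn_inj; rewrite -(size_char_poly A) charA size_prod_XsubC.
have [->|d0] := eqVneq d 0.
  rewrite scale0r subr0 det_scalar.
  under eq_bigr do rewrite mul0r subr0.
  by rewrite big_const_seq count_predT size_s iter_mulr_1.
have -> : c%:M - d *: A = d *: ((c / d)%:M - A).
  by rewrite scalerBr scale_scalar_mx mulrC divfK.
rewrite detZ.
have -> : \det ((c / d)%:M - A) = (char_poly A).[c / d].
  rewrite /char_poly -horner_evalE -det_map_mx /=; congr (\det _).
  apply/matrixP=> i j; rewrite !mxE /= horner_evalE.
  by rewrite hornerD hornerN hornerC hornerMn hornerX.
have -> : d ^+ n = \prod_(l <- s) d.
  by rewrite big_const_seq count_predT size_s iter_mulr_1.
rewrite charA horner_prod -big_split /=.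
by apply: eq_bigr => l _; rewrite !hornerE mulrBr mulrCA divff // mulr1.
Qed.

(* An involution anticommuting with another one has as many eigenvalues 1 as -1. *)
Lemma det_sub_anticommuting_involution_sqr (F : comNzRingType) n (E J : 'M[F]_n) (c : F) :
  E *m E = 1%:M -> J *m J = 1%:M -> E *m J *m E = - J ->
  (\det (1%:M - c *: J)) ^+ 2 = (1 - c ^+ 2) ^+ n.
Proof.
move=> EE JJ EJE.
have detEE : \det E * \det E = 1 by rewrite -det_mulmx EE det1.
(* Conjugation by [E] exchanges the two factors of [1 - c ^+ 2], so they have equal determinants. *)
have dE : \det (1%:M + c *: J) = \det (1%:M - c *: J).
  have -> : 1%:M + c *: J = E *m (1%:M - c *: J) *m E.
    rewrite mulmxBr mulmxBl mulmx1 EE -scalemxAr -scalemxAl EJE.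
    by rewrite scalerN opprK.
  by rewrite !det_mulmx mulrAC detEE mul1r.
rewrite expr2 -{2}dE -det_mulmx -det_scalar; congr (\det _).
rewrite mulmxBl mul1mx mulmxDr mulmx1 -scalemxAl -scalemxAr JJ scalerA -expr2.
by rewrite opprD addrA addrK scalemx1 raddfB.
Qed.

Lemma trig_mxX (F : pzRingType) n (A : 'M[F]_n) k : is_trig_mx A ->
  is_trig_mx (A ^+ k) /\ forall i, (A ^+ k) i i = A i i ^+ k.
Proof.
move=> /is_trig_mxP Atrig; elim: k => [|k [/is_trig_mxP trigk diagk]].
  by split=> [|i]; rewrite ?expr0 ?scalar_mx_is_trig // mxE eqxx.
split=> [|i].
  apply/is_trig_mxP => i j lt_ij; rewrite exprS mxE big1 // => l _.
  have [lt_il|le_li] := ltnP i l; first by rewrite Atrig // mul0r.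
  by rewrite trigk ?mulr0 // (leq_ltn_trans le_li).
rewrite !exprS mxE (bigD1 i) //= diagk big1 ?addr0 // => l.
rewrite neq_ltn => /orP[lt_li|lt_il]; first by rewrite trigk ?mulr0.
by rewrite Atrig // mul0r.
Qed.

Lemma char_poly_conjumx (F : fieldType) n (P A : 'M[F]_n) : P \in unitmx ->
  char_poly (P *m A *m invmx P) = char_poly A.
Proof.
move=> Pu; rewrite /char_poly /char_poly_mx !map_mxM.
set Q := map_mx polyC P; set Q' := map_mx polyC (invmx P).
have QQ' : Q *m Q' = 1%:M by rewrite -map_mxM mulmxV // map_mx1.
have -> : 'X%:M - Q *m map_mx polyC A *m Q' = Q *m ('X%:M - map_mx polyC A) *m Q'.
  by rewrite mulmxBr mulmxBl mul_mx_scalar -scalemxAl QQ' scalemx1.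
by rewrite !det_mulmx mulrAC -det_mulmx QQ' det1 mul1r.
Qed.

(** The diagonal of a Schur triangular form serves as one list for both claims: it gives the roots
    with multiplicity, and the diagonal of a power of a triangular matrix consists of the powers of
    its diagonal. *)
Lemma char_poly_split_trX (C : numClosedFieldType) n (A : 'M[C]_n) :
  exists2 s : seq C, char_poly A = \prod_(l <- s) ('X - l%:P) &
    forall k, \tr (A ^+ k) = \sum_(l <- s) l ^+ k.
Proof.
case: (posnP n) A => [->|n_gt0] A.
  exists [::] => [|k]; first by rewrite /char_poly det_mx00 big_nil.
  by rewrite /mxtrace big_ord0 big_nil.
have [P Punitary] := Schur A n_gt0.
have Pu := unitarymx_unit Punitary.
rewrite /similar_to conjumx //; set D := P *m A *m invmx P => Dtrig.
exists [seq D i i | i <- enum 'I_n] => [|k].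
  by rewrite -(char_poly_conjumx A Pu) char_poly_trig // big_map big_enum.
have -> : \tr (A ^+ k) = \tr (D ^+ k).
  have -> : D ^+ k = P *m A ^+ k *m invmx P.
    elim: k => [|k IHk]; first by rewrite !expr0 -[1]/1%:M mulmx1 mulmxV.
    by rewrite !exprSr IHk -!mulmxE /D !mulmxA mulmxKV.
  by rewrite mxtrace_mulC mulmxA mulVmx // mul1mx.
rewrite big_map big_enum /mxtrace; apply: eq_bigr => i _.
by have [_ ->] := trig_mxX k Dtrig.
Qed.

(** * Closed walks *)

(** Indexing through [enum_val] lets products be computed as sums over vertices or arcs instead of
    ordinals. *)
Definition kernel_mx (F : Type) (A B : finType) (w : A -> B -> F) :
  'M[F]_(#|A|, #|B|) := \matrix_(i, j) w (enum_val i) (enum_val j).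

Section KernelMatrix.
Variables (F : comNzRingType) (A B D : finType).

Lemma eq_kernel_mx (w w' : A -> B -> F) : w =2 w' -> kernel_mx w = kernel_mx w'.
Proof. by move=> ww'; apply/matrixP => i j; rewrite !mxE ww'. Qed.

Lemma kernel_mxM (w : A -> B -> F) (w' : B -> D -> F) :
  kernel_mx w *m kernel_mx w' = kernel_mx (fun x z => \sum_y w x y * w' y z).
Proof.
apply/matrixP => i j; rewrite !mxE (reindex (@enum_rank B)) /=; last first.
  exact/onW_bij/enum_rank_bij.
by apply: eq_bigr => y _; rewrite !mxE enum_rankK.
Qed.

Lemma kernel_mx_scalar (c : F) :
  c%:M = kernel_mx (fun x y : A => if x == y then c else 0).
Proof.
apply/matrixP => i j; rewrite !mxE (inj_eq enum_val_inj).
by case: eqP => _; rewrite ?mulr1n ?mulr0n.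
Qed.

Lemma kernel_mxD (w w' : A -> B -> F) :
  kernel_mx w + kernel_mx w' = kernel_mx (fun x y => w x y + w' x y).
Proof. by apply/matrixP => i j; rewrite !mxE. Qed.

Lemma kernel_mxN (w : A -> B -> F) : - kernel_mx w = kernel_mx (fun x y => - w x y).
Proof. by apply/matrixP => i j; rewrite !mxE. Qed.

Lemma kernel_mxZ c (w : A -> B -> F) : c *: kernel_mx w = kernel_mx (fun x y => c * w x y).
Proof. by apply/matrixP => i j; rewrite !mxE. Qed.

End KernelMatrix.

Section ClosedWalks.
Variables (F : comNzRingType) (A : finType) (w : A -> A -> F).

Fixpoint walk_weight (x : A) (s : seq A) : F :=
  if s is y :: s' then w x y * walk_weight y s' else 1.

Lemma walk_weightE x0 x s : walk_weight x s =
  \prod_(i < size s) w (nth x0 (x :: s) i) (nth x0 s i).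
Proof.
elim: s x => [|y s IHs] x /=; first by rewrite big_ord0.
by rewrite big_ord_recl /= IHs.
Qed.

Lemma big_tuple_cons k (G : k.+1.-tuple A -> F) :
  \sum_t G t = \sum_x \sum_(t : k.-tuple A) G [tuple of x :: t].
Proof.
rewrite pair_bigA /= (reindex (fun p : A * k.-tuple A => [tuple of p.1 :: p.2])) //=.
exists (fun t => (thead t, [tuple of behead t])) => [[x t] _ | t _] /=.
  by congr pair; apply: val_inj.
by rewrite [RHS]tuple_eta; apply: val_inj.
Qed.

(** The tuple [t] lists the [k] interior points of a walk with [k.+1] steps. *)
Lemma kernel_mxX k x y :
  (kernel_mx w ^+ k.+1) (enum_rank x) (enum_rank y) =
  \sum_(t : k.-tuple A) walk_weight x (rcons t y).
Proof.
elim: k x => [|k IHk] x.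
  rewrite expr1 mxE !enum_rankK (big_pred1 [tuple]) /= ?mulr1 // => t.
  by apply/esym/eqP; rewrite [t]tuple0.
rewrite exprS mxE big_tuple_cons.
rewrite (reindex (@enum_rank A)) /=; last exact/onW_bij/enum_rank_bij.
by apply: eq_bigr => z _; rewrite mxE !enum_rankK IHk mulr_sumr.
Qed.

Lemma mxtrace_kernel_mxX k :
  \tr (kernel_mx w ^+ k.+1) =
  \sum_(c : {ffun 'I_k.+1 -> A}) \prod_i w (c i) (c (ordS i)).
Proof.
rewrite /mxtrace (reindex (@enum_rank A)) /=; last exact/onW_bij/enum_rank_bij.
rewrite [RHS](reindex (fun t : k.+1.-tuple A => [ffun i => tnth t i])) /=; last first.
  exists (fun c : {ffun 'I_k.+1 -> A} => [tuple c i | i < k.+1]) => [t _|c _].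
    by apply: eq_from_tnth => i; rewrite tnth_mktuple ffunE.
  by apply/ffunP => i; rewrite ffunE tnth_mktuple.
rewrite big_tuple_cons; apply: eq_bigr => x _; rewrite kernel_mxX.
apply: eq_bigr => t _.
rewrite (walk_weightE x) size_rcons size_tuple; apply: eq_bigr => i _.
rewrite !ffunE !(tnth_nth x); congr (w _ _).
  by rewrite -rcons_cons nth_rcons /= size_tuple ltn_ord.
rewrite nth_rcons size_tuple /=.
(* [ordS] is the plain successor except at [i = k], where it wraps to 0; there the appended endpoint
   is again [x]. *)
have [lt_ik|le_ki] := ltnP i k; first by rewrite modn_small.
have -> : i = k :> nat by apply/eqP; rewrite eqn_leq le_ki -ltnS ltn_ord.
by rewrite eqxx modnn.
Qed.
End ClosedWalks.

(** * The complex logarithm *)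

Section ComplexExp.
Variable R : realType.
Implicit Types (x y t : R) (z w : Cplx R).

Lemma modC_normc z : modC z = Normc.normc z.
Proof. by case: z. Qed.

Lemma normC_modC z : `|z| = ((modC z)%:C)%C.
Proof. by case: z. Qed.

Lemma LogC_Complex z : LogC z = Complex (ln (modC z)) (ArgC z).
Proof.
by rewrite /LogC; apply/eqP; rewrite eq_complex /=; apply/andP; split; apply/eqP;
  ring.
Qed.

Lemma expC_Complex x y : expC (Complex x y) = Complex (expR x * cos y) (expR x * sin y).
Proof. by apply/eqP; rewrite eq_complex /=; apply/andP; split; apply/eqP; ring. Qed.

Lemma expCD z w : expC (z + w) = expC z * expC w.
Proof.
case: z w => [x y] [x' y'].
have -> : (Complex x y : Cplx R) + Complex x' y' = Complex (x + x') (y + y') by [].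
rewrite !expC_Complex; apply/eqP; rewrite eq_complex /= expRD cosD sinD.
by apply/andP; split; apply/eqP; ring.
Qed.

Lemma expC0 : expC (0 : Cplx R) = 1.
Proof. by rewrite -[0]/(Complex (0:R) 0) expC_Complex expR0 cos0 sin0 !mul1r. Qed.

Lemma expCN z : expC (- z) = (expC z)^-1.
Proof.
have E : expC z * expC (- z) = 1 by rewrite -expCD addrN expC0.
have nz : expC z != 0.
  by apply/eqP => z0; move: E; rewrite z0 mul0r => /esym/eqP; rewrite oner_eq0.
by apply: (mulfI nz); rewrite E divff.
Qed.

Lemma expC_sum (I : Type) (s : seq I) (F : I -> Cplx R) :
  expC (\sum_(i <- s) F i) = \prod_(i <- s) expC (F i).
Proof. exact: (big_morph _ expCD expC0). Qed.

(** The moduli determine the real parts. For the imaginary parts, equal sines and cosines give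
    [cos (y - y') = 1] with a difference smaller than [2 pi]. *)
Lemma expC_inj_strip z w : `|complex.Im z| < pi -> `|complex.Im w| < pi ->
  expC z = expC w -> z = w.
Proof.
case: z w => [x y] [x' y']; rewrite !expC_Complex /= !ltr_norml.
move=> /andP[y1 y2] /andP[y1' y2'] -[ec es].
have e2 : expR x = expR x'.
  have : expR x ^+ 2 = expR x' ^+ 2.
    rewrite -[LHS]mulr1 -[RHS]mulr1 -{1}(cos2Dsin2 y) -(cos2Dsin2 y').
    by rewrite !mulrDr -!exprMn ec es.
  by move/eqP; rewrite eqrXn2 ?expR_ge0 // => /eqP.
have xx : x = x' by apply: expR_inj.
have enz : expR x' != 0 by rewrite gt_eqF ?expR_gt0.
move: ec es; rewrite e2 => /(mulfI enz) ec /(mulfI enz) es.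
suff -> : y = y' by rewrite xx.
wlog yy : y y' y1 y2 y1' y2' ec es / y' <= y.
  by move=> H; case: (leP y' y) => [|/ltW] yy; [|apply/esym]; apply: H.
(* Pass to the half difference: it lies in [[0, pi)], where the sine vanishes only at 0. *)
have : cos (y - y') = 1 by rewrite cosB ec es -!expr2 cos2Dsin2.
have -> : y - y' = ((y - y') / 2) *+ 2 by rewrite -mulr_natr divfK ?pnatr_eq0.
rewrite cos_mulr2n cos2sin2 => h.
have /eqP : sin ((y - y') / 2) ^+ 2 = 0 by lra.
rewrite sqrf_eq0 => /eqP s0.
have [//|neq] := eqVneq y y'.
have yy' : y' < y by rewrite lt_neqAle eq_sym neq.
have : 0 < sin ((y - y') / 2) by apply: sin_gt0_pi; lra.
by rewrite s0 ltxx.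
Qed.

(** The right half-plane suffices, as the logarithms below are taken at [1 - w] with [|w| < 1];
    there [ArgC] is a single arctangent. *)
Lemma expC_LogC z : 0 < complex.Re z -> expC (LogC z) = z.
Proof.
case: z => [x y]; rewrite LogC_Complex expC_Complex /= => x0; rewrite x0.
have m0 : 0 < Num.sqrt (x ^+ 2 + y ^+ 2).
  by rewrite sqrtr_gt0 ltr_pwDl ?exprn_gt0 ?sqr_ge0.
rewrite lnK ?posrE //.
have sE : Num.sqrt (x ^+ 2 + y ^+ 2) * cos (atan (y / x)) = x.
  rewrite cos_atan.
  have -> : x ^+ 2 + y ^+ 2 = x ^+ 2 * (1 + (y / x) ^+ 2).
    by field; rewrite gt_eqF.
  rewrite sqrtrM ?sqr_ge0 // sqrtr_sqr gtr0_norm // mulfK //.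
  by rewrite gt_eqF // sqrtr_gt0 ltr_pwDl ?sqr_ge0.
have c0 : cos (atan (y / x)) != 0.
  by rewrite gt_eqF // cos_gt0_pihalf // atan_gtNpi2 atan_ltpi2.
have -> : sin (atan (y / x)) = y / x * cos (atan (y / x)).
  by rewrite -{2}(atanK (y / x)) /tan divfK.
by rewrite mulrCA sE divfK // gt_eqF.
Qed.

Lemma normr_atan_le x : `|atan x| <= `|x|.
Proof.
have main (u : R) : 0 < u -> `|atan u| <= u.
  move=> u0.
  have datan t : t \in `]0, u[%R -> is_derive t 1 atan (1 + t ^+ 2)^-1.
    by move=> _; exact: is_derive1_atan.
  have catan : {within `[0, u], continuous (@atan R)}.
    by apply: derivable_within_continuous => c _; exact: ex_derive.
  have [c _] := MVT u0 datan catan.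
  rewrite atan0 !subr0 => ->.
  have c1 : 1 <= 1 + c ^+ 2 by rewrite lerDl sqr_ge0.
  have c0 : 0 < 1 + c ^+ 2 by exact: lt_le_trans c1.
  by rewrite normrM (gtr0_norm u0) ler_piMl ?(ltW u0) // normfV gtr0_norm // invf_le1.
have [x0|x0|->] := ltrgtP x 0; last by rewrite atan0 normr0.
- by rewrite -(normrN (atan x)) -atanN (ltr0_norm x0) main // oppr_gt0.
- by rewrite (gtr0_norm x0) main.
Qed.

(** * The power series of the logarithm *)

Lemma normr_sub_le_deriv (f df : R -> R) (K : R) :
  (forall t, 0 <= t <= 1 -> is_derive t 1 f (df t)) ->
  (forall t, 0 <= t <= 1 -> `|df t| <= K) -> `|f 1 - f 0| <= K.
Proof.
move=> fdf dfK.
have fd t : t \in `]0, 1[%R -> is_derive t 1 f (df t).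
  by rewrite in_itv /= => /andP[? ?]; apply: fdf; rewrite !ltW.
have fc : {within `[0, 1], continuous f}.
  apply: derivable_within_continuous => t; rewrite in_itv /= => t01.
  by have ? := fdf t t01; exact: ex_derive.
have [c c01] := MVT ltr01 fd fc.
rewrite subr0 mulr1 => ->; apply: dfK.
by move: c01; rewrite in_itv /= => /andP[? ?]; rewrite !ltW.
Qed.

(** With [c k] the real or imaginary part of [z ^+ k.+1], this differentiates the truncated
    logarithm series along the segment from 0 to [z]. *)
Lemma is_derive_psum (c : nat -> R) N t :
  is_derive t 1 (fun t => \sum_(k < N) c k / k.+1%:R * t ^+ k.+1)
    (\sum_(k < N) c k * t ^+ k).
Proof.
pose p := \poly_(k < N) (c k / k.+1%:R) * 'X.
have -> : (fun t => \sum_(k < N) c k / k.+1%:R * t ^+ k.+1) = horner p.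
  apply/funext => u; rewrite hornerMX horner_poly mulr_suml.
  by apply: eq_bigr => k _; rewrite exprSr mulrA.
have -> : \sum_(k < N) c k * t ^+ k = p^`().[t].
  have -> : p^`() = \poly_(k < N) c k; last by rewrite horner_poly.
  apply/polyP => k; rewrite coef_deriv coefMX !coef_poly /=.
  case: ifP => _; last by rewrite mul0rn.
  by rewrite -[LHS]mulr_natr divfK ?pnatr_eq0.
exact: is_derive_poly.
Qed.

Lemma is_derive_sqr_mod x y t :
  is_derive t 1 (fun t => (1 - t * x) ^+ 2 + (t * y) ^+ 2)
    (2 * (t * y ^+ 2 - (1 - t * x) * x)).
Proof.
pose p : {poly R} := (1 - x *: 'X) ^+ 2 + (y *: 'X) ^+ 2.
have -> : (fun t => (1 - t * x) ^+ 2 + (t * y) ^+ 2) = horner p.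
  by apply/funext => u; rewrite !hornerE /= ![u * _]mulrC.
apply: (is_derive_eq (is_derive_poly p t)); rewrite /p !poly.derivE !hornerE /=; ring.
Qed.

(** For [z = x + i y] the function is twice the real part of [LogC (1 - t z)]; working with the
    squared modulus avoids differentiating a square root. *)
Lemma is_derive_ln_mod x y t : 0 < 1 - t * x ->
  is_derive t 1 (fun t => ln ((1 - t * x) ^+ 2 + (t * y) ^+ 2))
    (((1 - t * x) ^+ 2 + (t * y) ^+ 2)^-1 * (2 * (t * y ^+ 2 - (1 - t * x) * x))).
Proof.
move=> t1; have m0 : 0 < (1 - t * x) ^+ 2 + (t * y) ^+ 2.
  by rewrite ltr_pwDl ?exprn_gt0 ?sqr_ge0.
pose g u := (1 - u * x) ^+ 2 + (u * y) ^+ 2.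
have d1 : is_derive (g t) 1 (@ln R) (g t)^-1 by exact: is_derive1_ln.
exact: (@is_derive1_comp R (@ln R) g t _ _ d1 (is_derive_sqr_mod x y t)).
Qed.

(** The function is the imaginary part of [LogC (1 - t z)] for [z = x + i y]. *)
Lemma is_derive_arg x y t : 0 < 1 - t * x ->
  is_derive t 1 (fun t => atan (- (t * y) / (1 - t * x)))
    (- y / ((1 - t * x) ^+ 2 + (t * y) ^+ 2)).
Proof.
move=> t1; have t0 : 1 - t * x != 0 by rewrite gt_eqF.
pose p : {poly R} := - y *: 'X; pose r : {poly R} := 1 - x *: 'X.
have rt : r.[t] = 1 - t * x by rewrite !hornerE mulrC.
have -> : (fun t => atan (- (t * y) / (1 - t * x))) =
    atan \o (horner p * (fun t => (horner r t)^-1)).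
  apply/funext => u; rewrite -[RHS]/(atan (p.[u] * (r.[u])^-1)).
  by congr (atan (_ / _)); rewrite /p /r !hornerE; ring.
have dV : is_derive t 1 (fun t => (horner r t)^-1) (- (r.[t]) ^- 2 *: r^`().[t]).
  by apply: is_deriveV; rewrite ?rt.
have dM := is_deriveM (is_derive_poly p t) dV.
apply: (is_derive_eq (is_derive1_comp (is_derive1_atan _) dM)).
have -> : (horner p * (fun t => (r.[t])^-1)) t = - (t * y) / (1 - t * x).
  by rewrite -[LHS]/(p.[t] * (r.[t])^-1) rt /p !hornerE mulNr [y * t]mulrC.
rewrite /GRing.scale /= !rt !poly.derivE !hornerE /=; field.
by rewrite t0 andbT gt_eqF // ltr_pwDl ?exprn_gt0 ?sqr_ge0.
Qed.

Lemma modC_ge0 z : 0 <= modC z.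
Proof. by case: z => x y; exact: sqrtr_ge0. Qed.

Lemma modCM z w : modC (z * w) = modC z * modC w.
Proof. by rewrite !modC_normc; exact: Normc.normcM. Qed.

Lemma modCV z : modC z^-1 = (modC z)^-1.
Proof. by rewrite !modC_normc; exact: Normc.normcV. Qed.

Lemma modCN z : modC (- z) = modC z.
Proof. by case: z => x y; rewrite /modC /= !sqrrN. Qed.

Lemma modC1 : modC (1 : Cplx R) = 1.
Proof. by rewrite modC_normc; exact: Normc.normc1. Qed.

Lemma modC0 : modC (0 : Cplx R) = 0.
Proof. by rewrite modC_normc; exact: Normc.normc0. Qed.

Lemma modCX z n : modC (z ^+ n) = modC z ^+ n.
Proof. by elim: n => [|n IHn]; rewrite ?expr0 ?modC1 // !exprS modCM IHn. Qed.

Lemma modCD z w : modC (z + w) <= modC z + modC w.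
Proof.
have := ler_normD z w; rewrite !normC_modC -rmorphD /= lecR; exact.
Qed.

Lemma modC_real x : modC ((x%:C)%C : Cplx R) = `|x|.
Proof. by rewrite /modC /= expr0n addr0 sqrtr_sqr. Qed.

Lemma normr_Re_le z : `|complex.Re z| <= modC z.
Proof.
by case: z => x y; rewrite /modC /= -sqrtr_sqr ler_wsqrtr // lerDl sqr_ge0.
Qed.

Lemma normr_Im_le z : `|complex.Im z| <= modC z.
Proof.
by case: z => x y; rewrite /modC /= -sqrtr_sqr ler_wsqrtr // lerDr sqr_ge0.
Qed.

Lemma modC_le_ReIm z : modC z <= `|complex.Re z| + `|complex.Im z|.
Proof.
case: z => x y.
have -> : Complex x y = (x%:C)%C + Complex 0 y :> Cplx R.
  by apply/eqP; rewrite eq_complex /= addr0 add0r !eqxx.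
apply: le_trans (modCD _ _) _; rewrite modC_real /= addr0 add0r lerD2l.
by rewrite expr0n add0r sqrtr_sqr.
Qed.

Lemma Im_sum (I : Type) (s : seq I) (F : I -> Cplx R) :
  complex.Im (\sum_(i <- s) F i) = \sum_(i <- s) complex.Im (F i).
Proof. by apply: big_morph => // -[? ?] [? ?]. Qed.

Lemma Re_scale x z : complex.Re ((x%:C)%C * z : Cplx R) = x * complex.Re z.
Proof. by case: z => a b /=; rewrite mul0r subr0. Qed.

Lemma Im_scale x z : complex.Im ((x%:C)%C * z : Cplx R) = x * complex.Im z.
Proof. by case: z => a b /=; rewrite mul0r addr0. Qed.

(** For [w = t z] the left side is the derivative in [t] of [LogC (1 - t z)] plus its truncated
    series; the geometric sum cancels all but the tail. *)
Lemma geometric_remainder z w N : w != 1 ->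
  - z / (1 - w) + \sum_(k < N) z * w ^+ k = - z * w ^+ N / (1 - w).
Proof.
move=> w1; have w0 : 1 - w != 0 by rewrite subr_eq0 eq_sym.
rewrite -mulr_sumr; apply: (mulIf w0).
rewrite mulrDl !divfK // -mulrA [X in _ + z * X]mulrC.
have -> : (1 - w) * \sum_(k < N) w ^+ k = 1 - w ^+ N.
  by rewrite -opprB mulNr -subrX1 opprB.
ring.
Qed.

(* [- z / (1 - t z)] is the derivative of [t |-> LogC (1 - t z)]. *)
Lemma Re_Im_dLog x y t : 0 < 1 - t * x ->
  let A := (1 - t * x) ^+ 2 + (t * y) ^+ 2 in
  - Complex x y / (1 - (t%:C)%C * Complex x y) =
  Complex ((t * y ^+ 2 - (1 - t * x) * x) / A) (- y / A) :> Cplx R.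
Proof.
move=> t1 A; have A0 : A != 0.
  by rewrite gt_eqF // /A ltr_pwDl ?exprn_gt0 ?sqr_ge0.
have -> : 1 - (t%:C)%C * Complex x y = Complex (1 - t * x) (- (t * y)) :> Cplx R.
  by apply/eqP; rewrite eq_complex /=; apply/andP; split; apply/eqP; ring.
rewrite /A in A0 *.
by apply/eqP; rewrite eq_complex /= sqrrN; apply/andP; split; apply/eqP; field.
Qed.

(** The bound is uniform in [t], since [|w| <= |z|] and [|1 - w| >= 1 - |z|]. *)
Lemma modC_log_remainder z w t N : modC z < 1 -> 0 <= t <= 1 ->
  w = (t%:C)%C * z ->
  modC (- z / (1 - w) + \sum_(k < N) z * w ^+ k) <= modC z ^+ N.+1 / (1 - modC z).
Proof.
move=> z1 /andP[t0 t1] wE.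
have wz : modC w <= modC z.
  by rewrite wE modCM modC_real ger0_norm // ler_piMl ?modC_ge0.
have w1 : 1 - modC z <= modC (1 - w).
  have := modCD (1 - w) w; rewrite subrK modC1; lra.
have wn1 : w != 1.
  by apply/eqP => w_eq1; move: w1; rewrite w_eq1 subrr modC0; lra.
rewrite geometric_remainder // !modCM modCV modCN modCX exprS.
have r0 : 0 < 1 - modC z by lra.
apply: ler_pM.
- by rewrite mulr_ge0 ?exprn_ge0 ?modC_ge0.
- by rewrite invr_ge0 modC_ge0.
- by rewrite ler_wpM2l ?modC_ge0 // lerXn2r ?nnegrE ?modC_ge0.
- by rewrite lef_pV2 ?posrE // (lt_le_trans r0).
Qed.

(* Applied with [F] the real and the imaginary part. *)
Lemma log_series_remainder_component (F : Cplx R -> R) (g : R -> R) z N :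
  (forall v w, F (v + w) = F v + F w) ->
  (forall r w, F ((r%:C)%C * w) = r * F w) ->
  (forall w, `|F w| <= modC w) ->
  g 0 = 0 -> g 1 = F (LogC (1 - z)) ->
  (forall t, 0 <= t <= 1 -> is_derive t 1 g (F (- z / (1 - (t%:C)%C * z)))) ->
  modC z < 1 ->
  `|F (\sum_(k < N) z ^+ k.+1 / k.+1%:R + LogC (1 - z))| <=
    modC z ^+ N.+1 / (1 - modC z).
Proof.
move=> FD FZ Fle g0 g1 dg z1.
have F0 : F 0 = 0 by have := FZ 0 0; rewrite !mul0r => ->.
have Fsum (n : nat) (G : nat -> Cplx R) :
    F (\sum_(k < n) G k) = \sum_(k < n) F (G k) by exact: big_morph.
pose c k := F (z ^+ k.+1).
pose S t := \sum_(k < N) c k / k.+1%:R * t ^+ k.+1.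
have S0 : S 0 = 0 by rewrite /S big1 // => k _; rewrite expr0n mulr0.
have S1 : S 1 = F (\sum_(k < N) z ^+ k.+1 / k.+1%:R).
  rewrite (Fsum N (fun k => z ^+ k.+1 / k.+1%:R)); apply: eq_bigr => k _.
  have -> : (k.+1%:R : Cplx R)^-1 = ((k.+1%:R^-1)%:C)%C.
    by rewrite fmorphV rmorph_nat.
  by rewrite [z ^+ _ * _]mulrC FZ expr1n mulr1 mulrC.
(* The error is the increment of [g + S] over [[0, 1]], and the derivative of [g + S] is [F] of the
   geometric remainder. *)
have -> : F (\sum_(k < N) z ^+ k.+1 / k.+1%:R + LogC (1 - z)) =
    (g + S) 1 - (g + S) 0.
  rewrite -[(g + S) 1]/(g 1 + S 1) -[(g + S) 0]/(g 0 + S 0).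
  by rewrite S0 S1 g0 g1 addr0 subr0 FD addrC.
apply: (@normr_sub_le_deriv _ (fun t => F (- z / (1 - (t%:C)%C * z)) +
    \sum_(k < N) c k * t ^+ k)) => t t01.
  by apply: is_deriveD; [exact: dg | exact: is_derive_psum].
apply: le_trans (modC_log_remainder N z1 t01 erefl).
suff -> : \sum_(k < N) c k * t ^+ k = F (\sum_(k < N) z * ((t%:C)%C * z) ^+ k).
  by rewrite -FD; exact: Fle.
rewrite (Fsum N (fun k => z * ((t%:C)%C * z) ^+ k)); apply: eq_bigr => k _.
by rewrite exprMn -rmorphXn /= mulrCA -exprS FZ mulrC.
Qed.

(** The mean value theorem is real, so the real and imaginary parts are bounded separately; adding
    the two bounds gives the factor 2. *)
Lemma log_series_remainder_le z N : modC z < 1 ->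
  modC (\sum_(k < N) z ^+ k.+1 / k.+1%:R + LogC (1 - z)) <=
    2 * (modC z ^+ N.+1 / (1 - modC z)).
Proof.
case: z => x y; set z := Complex x y => z1.
have tx1 t : 0 <= t <= 1 -> 0 < 1 - t * x.
  move=> /andP[t0 t1]; have xz := normr_Re_le z.
  have : t * x < 1; last by lra.
  apply: le_lt_trans z1; apply: le_trans xz; apply: le_trans (ler_norm _) _.
  by rewrite normrM ger0_norm // ler_piMl.
have x1 : 0 < 1 - x by rewrite -[x]mul1r tx1 // ler01 lexx.
have E1 : 1 - z = Complex (1 - x) (- y).
  by apply/eqP; rewrite eq_complex /= sub0r !eqxx.
apply: le_trans (modC_le_ReIm _) _; rewrite mulr_natl mulr2n; apply: lerD.
- apply: (log_series_remainder_component
    (g := 2^-1 \*: (fun t => ln ((1 - t * x) ^+ 2 + (t * y) ^+ 2)))) => //.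
  + by move=> [? ?] [? ?].
  + exact: Re_scale.
  + exact: normr_Re_le.
  + rewrite -[LHS]/(2^-1 * ln ((1 - 0 * x) ^+ 2 + (0 * y) ^+ 2)).
    by rewrite !mul0r subr0 expr0n expr1n addr0 ln1 mulr0.
  + rewrite -[LHS]/(2^-1 * ln ((1 - 1 * x) ^+ 2 + (1 * y) ^+ 2)).
    rewrite E1 LogC_Complex /= !mul1r sqrrN.
    have m0 : 0 < (1 - x) ^+ 2 + y ^+ 2 by rewrite ltr_pwDl ?exprn_gt0 ?sqr_ge0.
    rewrite -{1}(sqr_sqrtr (ltW m0)) lnXn ?sqrtr_gt0 //; by field.
  + move=> t t01; have dA := is_derive_ln_mod y (tx1 t t01).
    apply: (is_derive_eq (is_deriveZ 2^-1 dA)).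
    rewrite Re_Im_dLog ?tx1 //= /GRing.scale /= mulrCA mulKf ?pnatr_eq0 //.
    by rewrite mulrC.
- apply: (log_series_remainder_component
    (g := fun t => atan (- (t * y) / (1 - t * x)))) => //.
  + by move=> [? ?] [? ?].
  + exact: Im_scale.
  + exact: normr_Im_le.
  + by rewrite mul0r oppr0 mul0r atan0.
  + by rewrite E1 LogC_Complex /= x1 !mul1r.
  + move=> t t01; rewrite Re_Im_dLog ?tx1 //=.
    exact: is_derive_arg (tx1 t t01).
Qed.

Lemma log_series_cvg z : modC z < 1 ->
  series (fun k => z ^+ k.+1 / k.+1%:R) @ \oo --> - LogC (1 - z).
Proof.
move=> z1; apply/cvgrPdist_lt => eps eps0.
(* In the order on complex numbers a positive [eps] has zero imaginary part. *)
have := eps0; rewrite ltcE /= => /andP[/eqP im0 re0].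
have epsE : eps = ((complex.Re eps)%:C)%C by case: eps im0 {eps0 re0} => a b /= ->.
have : (fun n => 2 * (modC z ^+ n.+1 / (1 - modC z))) @ \oo --> (0 : R).
  under eq_fun do rewrite exprS mulrAC mulrA.
  by apply: cvg_geometric; rewrite ger0_norm ?modC_ge0.
move=> /cvgrPdist_lt /(_ _ re0); apply: filterS => n.
rewrite epsE normC_modC ltcR sub0r normrN => h.
apply: le_lt_trans (le_lt_trans (ler_norm _) h).
rewrite -modCN opprB opprK /series /= big_mkord; exact: log_series_remainder_le.
Qed.

(** Here [Re (1 - z) >= 1/2], so the quotient inside the arctangent is at most [2 |y|]. This is what
    keeps sums of logarithms inside the strip of injectivity. *)
Lemma normr_Arg_le z : modC z <= 2^-1 -> `|complex.Im (LogC (1 - z))| <= 2 * modC z.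
Proof.
case: z => x y; set z := Complex x y; set r := modC z => z2.
have xz : `|x| <= r by exact: (normr_Re_le z).
have yz : `|y| <= r by exact: (normr_Im_le z).
have x1 : 2^-1 <= 1 - x by have := ler_norm x; lra.
have x0 : 0 < 1 - x by lra.
have -> : 1 - z = Complex (1 - x) (- y).
  by apply/eqP; rewrite eq_complex /= sub0r !eqxx.
rewrite LogC_Complex /= x0; apply: le_trans (normr_atan_le _) _.
rewrite normrM normrN normfV (gtr0_norm x0) ler_pdivrMr //.
have r0 : 0 <= r by exact: modC_ge0.
by apply: le_trans yz _; nra.
Qed.

End ComplexExp.

(** * Arc matrices *)

Section ArcMatrices.
Variables (F : fieldType) (T : finType) (e : rel T) (q : nat).
Hypotheses (e_sym : symmetric e) (e_irr : irreflexive e).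
Hypothesis e_reg : forall v : T, deg e v = q.+1.

Definition arc_inv (f : arc e) : arc e :=
  exist _ (arc_t f, arc_o f) (etrans (e_sym (arc_t f) (arc_o f)) (valP f)).

Lemma arc_eq (f g : arc e) : (f == g) = (arc_o f == arc_o g) && (arc_t f == arc_t g).
Proof. by case: f g => [[v w] ?] [[v' w'] ?]. Qed.

Lemma big_arc (S : Type) (idx : S) (op : Monoid.com_law idx) (G : T -> T -> S) :
  \big[op/idx]_(f : arc e) G (arc_o f) (arc_t f) =
  \big[op/idx]_v \big[op/idx]_(w | e v w) G v w.
Proof.
rewrite pair_big_dep /=.
rewrite (reindex_omap (fun f : arc e => val f) insub) /=; last first.
  by move=> p ep; rewrite insubT.
apply: eq_bigl => f; rewrite valK eqxx andbT; exact/esym/(valP f).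
Qed.

Lemma card_arc : #|{: arc e}| = (#|T| * q.+1)%N.
Proof.
rewrite -sum1_card (big_arc _ (fun _ _ => 1%N)) -sum_nat_const.
apply: eq_bigr => v _; rewrite -(e_reg v) /deg -sum1_card.
by apply: eq_bigl => w; rewrite inE.
Qed.

Definition head_mx : 'M[F]_(#|{: arc e}|, #|T|) :=
  kernel_mx (fun (f : arc e) v => if arc_t f == v then 1 else 0).
Definition tail_mx : 'M[F]_(#|{: arc e}|, #|T|) :=
  kernel_mx (fun (f : arc e) v => if arc_o f == v then 1 else 0).
Definition out_mx : 'M[F]_(#|T|, #|{: arc e}|) :=
  kernel_mx (fun v (f : arc e) => if arc_o f == v then 1 else 0).
Definition rev_mx : 'M[F]_#|{: arc e}| :=
  kernel_mx (fun f g : arc e => if g == arc_inv f then 1 else 0).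
(** Diagonal signs of the orientation of edges induced by the enumeration of the vertices. *)
Definition orient_mx : 'M[F]_#|{: arc e}| :=
  kernel_mx (fun f g : arc e => if f == g then
    (-1) ^+ (enum_rank (arc_o f) < enum_rank (arc_t f))%N else 0).
Definition adj_mx : 'M[F]_#|T| :=
  kernel_mx (fun v w => if e v w then 1 else 0).

Lemma arc_invK : involutive arc_inv.
Proof. by move=> f; apply/eqP; rewrite arc_eq !eqxx. Qed.

Lemma sum_deltal (I : finType) (i : I) (G : I -> F) :
  \sum_j (if j == i then 1 else 0) * G j = G i.
Proof.
by rewrite (bigD1 i) //= eqxx mul1r big1 ?addr0 // => j /negPf ->; rewrite mul0r.
Qed.

Lemma rev_mx_sqr : rev_mx *m rev_mx = 1%:M.
Proof.
rewrite kernel_mxM kernel_mx_scalar; apply: eq_kernel_mx => f g.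
by rewrite sum_deltal arc_invK eq_sym.
Qed.

Lemma rev_head_mx : rev_mx *m head_mx = tail_mx.
Proof. by rewrite kernel_mxM; apply: eq_kernel_mx => f v; rewrite sum_deltal. Qed.

Lemma out_head_mx : out_mx *m head_mx = adj_mx.
Proof.
rewrite kernel_mxM; apply: eq_kernel_mx => v w.
rewrite (big_arc _ (fun v' w' =>
  (if v' == v then 1 else 0) * (if w' == w then 1 else 0))).
rewrite (bigD1 v) //= [X in _ + X]big1 ?addr0; last first.
  by move=> v' /negPf ->; rewrite big1 // => *; rewrite mul0r.
rewrite eqxx; have [evw|nevw] := boolP (e v w).
  rewrite (bigD1 w) //= eqxx mulr1 big1 ?addr0 // => w' /andP[_ /negPf ->].
  by rewrite mulr0.
by rewrite big1 // => w' evw'; case: eqP evw' nevw => [-> ->|]; rewrite ?mulr0.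
Qed.

Lemma out_tail_mx : out_mx *m tail_mx = (q.+1%:R)%:M.
Proof.
rewrite kernel_mxM kernel_mx_scalar; apply: eq_kernel_mx => v w.
rewrite (big_arc _ (fun v' _ =>
  (if v' == v then 1 else 0) * (if v' == w then 1 else 0))).
rewrite (bigD1 v) //= [X in _ + X]big1 ?addr0; last first.
  by move=> v' /negPf ->; rewrite big1 // => *; rewrite mul0r.
rewrite eqxx mul1r sumr_const; case: eqP => _; last by rewrite mul0rn.
by rewrite -(e_reg v) /deg cardsE.
Qed.

Lemma orient_mx_sqr : orient_mx *m orient_mx = 1%:M.
Proof.
rewrite kernel_mxM kernel_mx_scalar; apply: eq_kernel_mx => f g.
rewrite (bigD1 f) //= eqxx big1 ?addr0; last first.
  by move=> h; rewrite eq_sym => /negPf ->; rewrite mul0r.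
by case: eqP => _; rewrite ?mulr0 // -expr2 sqrr_sign.
Qed.

(** Without loops the two ends of an arc have distinct ranks, so an arc and its reversal carry
    opposite signs. *)
Lemma orient_rev_mx : orient_mx *m rev_mx *m orient_mx = - rev_mx.
Proof.
rewrite !kernel_mxM kernel_mxN; apply: eq_kernel_mx => f g.
rewrite (bigD1 g) //= eqxx [X in _ + X]big1 ?addr0; last first.
  by move=> h /negPf ->; rewrite mulr0.
rewrite (bigD1 f) //= eqxx [X in _ + X]big1 ?addr0; last first.
  by move=> h; rewrite eq_sym => /negPf ->; rewrite mul0r.
case: eqP => [->|_]; last by rewrite mulr0 mul0r oppr0.
rewrite mulr1 -signr_addb /= /arc_inv {2}/arc_o {2}/arc_t /=.
have : arc_o f != arc_t f.
  by apply/eqP => ot; have := valP f; rewrite -/(arc_o f) -/(arc_t f) -ot e_irr.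
rewrite -(inj_eq enum_rank_inj) -val_eqE /= neq_ltn.
by case: ltngtP.
Qed.

(** The form of [weight] on a regular graph, where the degree-dependent coefficient is a constant
    [c]. *)
Definition arc_weight (c b : F) (f g : arc e) : F :=
  if arc_t f == arc_o g then (if arc_o f == arc_t g then c else c + b) else 0.

(** Every pair of consecutive arcs receives [c + b] through the common vertex; subtracting [b] at
    reversals corrects the backtracking pairs. *)
Lemma arc_weight_mx c b :
  kernel_mx (arc_weight c b) = (c + b) *: (head_mx *m out_mx) - b *: rev_mx.
Proof.
rewrite kernel_mxM !kernel_mxZ kernel_mxN kernel_mxD; apply: eq_kernel_mx => f g.
under eq_bigr => v _ do rewrite [arc_t f == v]eq_sym.
rewrite sum_deltal /arc_weight.
have -> : (g == arc_inv f) = (arc_t f == arc_o g) && (arc_o f == arc_t g).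
  by rewrite arc_eq ![_ == arc_o g]eq_sym ![_ == arc_t g]eq_sym.
rewrite [arc_o g == _]eq_sym.
by case: eqP => _; case: eqP => _ /=; rewrite ?mulr0 ?mulr1 ?subr0 ?addrK.
Qed.

(* The factor [(1 + s J)(1 - s J) = 1 - s^2], with [J] the arc reversal and
   [s = u b], turns the arc matrix into a scalar plus a matrix of rank at most
   [#|T|]; squaring replaces [det (1 - s J)] by a power of [1 - s^2]. *)
Lemma det_arc_weight_sqr (c b u : F) :
  let d := 1 - (u * b) ^+ 2 in let t := u * (c + b) in
  d != 0 ->
  d ^+ (2 * #|T|) * \det (1%:M - u *: kernel_mx (arc_weight c b)) ^+ 2 =
  d ^+ (#|T| * q.+1) * \det ((d + t * (u * b) * q.+1%:R)%:M - t *: adj_mx) ^+ 2.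
Proof.
move=> d t d0; set s := u * b; set n := #|T|; set p := (n * q.+1)%N.
have Jdet : \det (1%:M - s *: rev_mx) ^+ 2 = d ^+ p.
  rewrite (det_sub_anticommuting_involution_sqr s orient_mx_sqr rev_mx_sqr orient_rev_mx).
  by rewrite card_arc.
have main : d ^+ n * (\det (1%:M - s *: rev_mx) *
    \det (1%:M - u *: kernel_mx (arc_weight c b))) =
    d ^+ p * \det ((d + t * s * q.+1%:R)%:M - t *: adj_mx).
  rewrite -det_mulmx.
  have -> : (1%:M - s *: rev_mx) *m (1%:M - u *: kernel_mx (arc_weight c b)) =
      d%:M - (t *: (head_mx - s *: tail_mx)) *m out_mx.
    rewrite arc_weight_mx scalerBr !scalerA -/s -/t opprB addrA.
    rewrite mulmxDr; congr (_ + _).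
      rewrite mulmxBl mul1mx mulmxDr mulmx1 -scalemxAl -scalemxAr rev_mx_sqr.
      by rewrite scalerA -expr2 opprD addrA addrK scalemx1 raddfB.
    rewrite mulmxN; congr (- _).
    by rewrite -scalemxAr -!scalemxAl mulmxA mulmxBl mul1mx -scalemxAl rev_head_mx.
  rewrite det_scalar_sub_mulC; congr (_ * _); first by rewrite card_arc.
  congr (\det _).
  rewrite -scalemxAr mulmxBr out_head_mx -scalemxAr out_tail_mx scale_scalar_mx.
  rewrite scalerBr scale_scalar_mx opprB addrA mulrA.
  by rewrite [(d + _)%:M]raddfD.
(* Squaring [main] turns the determinant of [1 - s J] into one more factor [d ^+ p], which then
   cancels. *)
have dp : d ^+ p != 0 by rewrite expf_neq0.
apply: (mulfI dp).
have := congr1 (fun z => z ^+ 2) main; rewrite !exprMn Jdet => main2.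
by rewrite [LHS]mulrCA [(2 * n)%N]mulnC (exprM d n 2) main2 [RHS]mulrA -expr2.
Qed.

End ArcMatrices.

(** * Cycle sums and vertex-transitivity *)

Section CycleSums.
Variables (R : realType) (T : finType) (e : rel T) (a b : R).
Hypothesis e_vt : vertex_transitive e.

Lemma N0_tail x k : N0 e a b x k =
  \sum_(c : {ffun 'I_k.+1 -> arc e} | arc_o (c ord0) == x) cycle_weight a b c.
Proof.
rewrite /N0 [RHS](bigID (fun c : {ffun 'I_k.+1 -> arc e} =>
  [forall i, arc_t (c i) == arc_o (c (ordS i))])) /=.
rewrite [X in _ = _ + X]big1 ?addr0; last first.
  move=> c /andP[_]; rewrite negb_forall => /existsP[i nci].
  by rewrite /cycle_weight (bigD1 i) //= /weight (negPf nci) mul0r.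
by apply: eq_bigl => c; rewrite andbC.
Qed.

(** An automorphism taking [x] to [y] preserves degrees, hence weights, and permutes the sequences
    of arcs. *)
Lemma N0_transitive x y k : N0 e a b x k = N0 e a b y k.
Proof.
have [h [hxy he]] := e_vt x y.
have hinj : injective h by exact: perm_inj.
have [h' hK h'K] := injF_bij hinj.
have hdeg v : deg e (h v) = deg e v.
  rewrite /deg -[RHS](card_imset _ hinj); apply: eq_card => w.
  rewrite !inE; apply/idP/imsetP => [ew|[w' ew' ->]]; last by rewrite inE he in ew' *.
  by exists (h' w); rewrite ?h'K // inE -he h'K.
pose ha (f : arc e) : arc e :=
  exist _ (h (arc_o f), h (arc_t f)) (etrans (he (arc_o f) (arc_t f)) (valP f)).
have hainj : injective ha.
  by move=> f g [/hinj oo /hinj tt]; apply/eqP; rewrite arc_eq oo tt !eqxx.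
have hw f g : weight a b (ha f) (ha g) = weight a b f g.
  by rewrite /weight /= /arc_t /arc_o /= hdeg !(inj_eq hinj).
rewrite !N0_tail [RHS](reindex (fun c : {ffun 'I_k.+1 -> arc e} =>
  [ffun i => ha (c i)])) /=.
  apply: eq_big => [c|c _]; first by rewrite ffunE /arc_o /= -hxy (inj_eq hinj).
  by apply: eq_bigr => i _; rewrite !ffunE hw.
apply: onW_bij; apply: injF_bij => c c' /ffunP cc'; apply/ffunP => i.
by have := cc' i; rewrite !ffunE => /hainj.
Qed.

Lemma card_N0 x k :
  (#|T|%:R * N0 e a b x k)%:C%C =
  \tr (kernel_mx (fun f g : arc e => ((weight a b f g)%:C)%C) ^+ k.+1) :> Cplx R.
Proof.
rewrite mxtrace_kernel_mxX.
have -> : #|T|%:R * N0 e a b x k = \sum_y N0 e a b y k.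
  rewrite (eq_bigr (fun=> N0 e a b x k)) => [|y _]; last exact: N0_transitive.
  by rewrite sumr_const mulr_natl.
have -> : \sum_y N0 e a b y k = \sum_(c : {ffun 'I_k.+1 -> arc e}) cycle_weight a b c.
  rewrite [RHS](partition_big (fun c : {ffun 'I_k.+1 -> arc e} =>
    arc_o (c ord0)) predT) //=.
  by apply: eq_bigr => y _; exact: N0_tail.
rewrite rmorph_sum /=; apply: eq_bigr => c _; exact: rmorph_prod.
Qed.

End CycleSums.

(** * The zeta function *)

Section SmallArguments.
Variable R : realType.
Implicit Types (u z : Cplx R) (p : Cplx R * Cplx R) (ps : seq (Cplx R * Cplx R)).

(** The common shape of all factors: [1 - quad p u] covers [1 - u l], [1 - b^2 u^2] and the
    quadratic factors of both formulas. *)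
Definition quad p u : Cplx R := u * (p.1 + p.2 * u).

Lemma quad_small ps (eps : R) : 0 < eps -> exists2 delta : R, 0 < delta &
  forall u, modC u < delta -> forall p, p \in ps -> modC (quad p u) < eps.
Proof.
move=> eps0; pose K := 1 + \sum_(p <- ps) (modC p.1 + modC p.2).
have bnd_ge0 p : 0 <= modC p.1 + modC p.2 by rewrite addr_ge0 ?modC_ge0.
have K0 : 0 < K by rewrite ltr_pwDl ?sumr_ge0.
(* The bound 1 on [|u|] absorbs the quadratic term into [K]; the summand 1 in [K] keeps it
   positive. *)
exists (Num.min 1 (eps / K)); first by rewrite lt_min ltr01 divr_gt0.
move=> u; rewrite lt_min ltr_pdivlMr // => /andP[u1 uK] p pps.
apply: le_lt_trans uK; rewrite modCM ler_wpM2l ?modC_ge0 //.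
apply: le_trans (modCD _ _) _; rewrite modCM.
have -> : K = modC p.1 + modC p.2 + (K - (modC p.1 + modC p.2)) by ring.
apply: ler_wpDr.
  rewrite /K (big_rem p) //= addrCA [X in X - _]addrC addrK ltW //.
  by rewrite ltr_pwDl ?sumr_ge0.
by rewrite lerD2l ler_piMr ?modC_ge0 // ltW.
Qed.

Lemma expC_sum_LogC ps u : (forall p, p \in ps -> modC (quad p u) < 1) ->
  expC (\sum_(p <- ps) LogC (1 - quad p u)) = \prod_(p <- ps) (1 - quad p u).
Proof.
move=> small; rewrite expC_sum; apply: eq_big_seq => p pps; apply: expC_LogC.
have := le_lt_trans (normr_Re_le _) (small _ pps).
by case: (quad p u) => x y /=; rewrite ltr_norml => /andP[_ x1]; rewrite subr_gt0.
Qed.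

(** The radius depends only on the two lists, while equality of the products is required only at the
    given [u]. *)
Lemma sum_LogC_unique ps ps' : exists2 delta : R, 0 < delta &
  forall u, modC u < delta ->
  \prod_(p <- ps) (1 - quad p u) = \prod_(p <- ps') (1 - quad p u) ->
  \sum_(p <- ps) LogC (1 - quad p u) = \sum_(p <- ps') LogC (1 - quad p u).
Proof.
pose N := (size (ps ++ ps')).+1.
have pi0 : 0 < pi :> R := pi_gt0 R.
(* The bound [2^-1] permits [normr_Arg_le], and the other one makes each argument at most [pi / N],
   with [N] larger than either list. *)
have eps0 : 0 < Num.min 2^-1 (pi / (2 * N%:R)) :> R.
  by rewrite lt_min invr_gt0 ltr0n divr_gt0 ?mulr_gt0 ?ltr0n.
have [delta delta0 small] := quad_small (ps ++ ps') eps0.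
exists delta => // u ud eqp.
have strip qs : {subset qs <= ps ++ ps'} -> (size qs < N)%N ->
    expC (\sum_(p <- qs) LogC (1 - quad p u)) = \prod_(p <- qs) (1 - quad p u) /\
    `|complex.Im (\sum_(p <- qs) LogC (1 - quad p u))| < pi.
  move=> sub sz; have sm p : p \in qs -> modC (quad p u) < Num.min 2^-1 (pi / (2 * N%:R)).
    by move=> /sub; exact: small.
  split.
    apply: expC_sum_LogC => p /sm; rewrite lt_min => /andP[+ _]; lra.
  rewrite Im_sum; apply: le_lt_trans (ler_norm_sum _ _ _) _.
  apply: (@le_lt_trans _ _ (\sum_(p <- qs) (pi / N%:R))).
    rewrite big_seq [leRHS]big_seq; apply: ler_sum => p /sm.
    rewrite lt_min => /andP[/ltW z2 zpi]; apply: le_trans (normr_Arg_le z2) _.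
    have -> : pi / N%:R = 2 * (pi / (2 * N%:R)) :> R.
      by field; rewrite pnatr_eq0.
    by rewrite ler_wpM2l // ltW.
  rewrite big_const_seq count_predT iter_addr_0 -[_ *+ size qs]mulr_natr mulrAC.
  by rewrite ltr_pdivrMr ?ltr0n // ltr_pM2l // ltr_nat.
have sub1 : {subset ps <= ps ++ ps'} by move=> p pp; rewrite mem_cat pp.
have sub2 : {subset ps' <= ps ++ ps'} by move=> p pp; rewrite mem_cat pp orbT.
have sz1 : (size ps < N)%N by rewrite /N size_cat ltnS leq_addr.
have sz2 : (size ps' < N)%N by rewrite /N size_cat ltnS leq_addl.
have [E1 I1] := strip _ sub1 sz1; have [E2 I2] := strip _ sub2 sz2.
by apply: expC_inj_strip => //; rewrite E1 E2.
Qed.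

End SmallArguments.

Lemma cvg_sum_seq (R : realType) (I : eqType) (s : seq I) (f : I -> nat -> Cplx R)
    (l : I -> Cplx R) :
  (forall i, i \in s -> f i @ \oo --> l i) ->
  (fun n => \sum_(i <- s) f i n) @ \oo --> \sum_(i <- s) l i.
Proof.
elim: s => [|i s IHs] fl.
  under eq_fun do rewrite big_nil; rewrite big_nil; exact: cvg_cst.
under eq_fun do rewrite big_cons; rewrite big_cons; apply: cvgD.
  by apply: fl; rewrite mem_head.
by apply: IHs => j js; apply: fl; rewrite in_cons js orbT.
Qed.

Section Zeta.
Variables (R : realType) (T : finType) (e : rel T) (x0 : T) (q : nat) (a b : R).
Hypotheses (e_sym : symmetric e) (e_irr : irreflexive e).
Hypothesis e_vt : vertex_transitive e.
Hypothesis e_reg : forall v : T, deg e v = q.+1.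

Let n := #|T|.
Let c : R := (2 / q.+1%:R - 1) * a.
Let B := kernel_mx (@arc_weight (Cplx R) T e (c%:C)%C (b%:C)%C).

Lemma card_N0_spec (s : seq (Cplx R)) k :
  (forall k, \tr (B ^+ k) = \sum_(l <- s) l ^+ k) ->
  ((N0 e a b x0 k)%:C)%C = (n%:R)^-1 * \sum_(l <- s) l ^+ k.+1 :> Cplx R.
Proof.
have n0 : (n%:R : Cplx R) != 0.
  by rewrite pnatr_eq0 -lt0n; apply/card_gt0P; exists x0.
move=> trB; apply: (mulfI n0); rewrite mulVKf // -trB.
have -> : B = kernel_mx (fun f g : arc e => ((weight a b f g)%:C)%C).
  apply: eq_kernel_mx => f g; rewrite /arc_weight /weight e_reg -/c.
  by case: eqP => // _; case: eqP => // _; rewrite rmorphD.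
by rewrite -(card_N0 _ _ e_vt x0) rmorphM /= rmorph_nat.
Qed.

(** The partial sums split as a finite sum over the eigenvalues, each contributing a logarithm
    series. *)
Lemma zeta_series_cvg (s : seq (Cplx R)) (u : Cplx R) :
  (forall k, \tr (B ^+ k) = \sum_(l <- s) l ^+ k) ->
  (forall l, l \in s -> modC (u * l) < 1) ->
  series (zeta_term e a b x0 u) @ \oo -->
    - ((n%:R)^-1 * \sum_(l <- s) LogC (1 - u * l)).
Proof.
move=> trB small.
have -> : series (zeta_term e a b x0 u) = fun N => (n%:R)^-1 *
    \sum_(l <- s) series (fun k => (u * l) ^+ k.+1 / k.+1%:R) N.
  apply/funext => N; rewrite /series /= exchange_big /= mulr_sumr.
  apply: eq_bigr => k _; rewrite /zeta_term (card_N0_spec k trB).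
  rewrite -!mulrA; congr (_ * _); rewrite mulr_suml; apply: eq_bigr => l _.
  by rewrite mulrCA mulrC exprMn [u ^+ _ * _]mulrC.
rewrite -mulrN -sumrN; apply: cvgMl_tmp.
by apply: cvg_sum_seq => l ls; exact: log_series_cvg (small l ls).
Qed.

(** Common source of both formulas: they differ only in the list [ps] that factors the determinant
    on the vertices. *)
Lemma zeta_formula (ps : seq (Cplx R * Cplx R)) :
  (forall u : Cplx R, let t := u * ((c%:C)%C + (b%:C)%C) in
    \det ((1 - (u * (b%:C)%C) ^+ 2 + t * (u * (b%:C)%C) * q.+1%:R)%:M -
      t *: adj_mx (Cplx R) e) =
    \prod_(p <- ps) (1 - quad p u)) ->
  exists2 delta : R, 0 < delta & forall u : Cplx R, modC u < delta ->
    cvgn (series (zeta_term e a b x0 u)) /\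
    (zeta_ab e a b x0 u)^-1 =
      powC (1 - ((b ^+ 2)%:C)%C * u ^+ 2) ((((q%:R - 1) / 2 : R)%:C)%C) *
      expC ((n%:R)^-1 * \sum_(p <- ps) LogC (1 - quad p u)).
Proof.
move=> detps; have [s charB trB] := @char_poly_split_trX R[i] _ B.
pose sp := [seq (l, 0 : Cplx R) | l <- s].
pose p2 : Cplx R * Cplx R := (0, ((b ^+ 2)%:C)%C).
have p2E u : quad p2 u = ((b ^+ 2)%:C)%C * u ^+ 2.
  by rewrite /quad /= add0r mulrCA -expr2.
(* The two lists encode the two sides of [det_arc_weight_sqr]; doubling [sp] and [ps] accounts for
   the squares. *)
pose ps1 := nseq (2 * n) p2 ++ sp ++ sp.
pose ps2 := nseq (n * q.+1) p2 ++ ps ++ ps.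
have [d1 d10 uniq12] := sum_LogC_unique ps1 ps2.
have [d2 d20 small] := quad_small (p2 :: sp) ltr01.
exists (Num.min d1 d2); first by rewrite lt_min d10.
move=> u; rewrite lt_min => /andP[ud1 ud2].
(* Stated for any commutative monoid law, to serve both for products of factors and for sums of
   logarithms. *)
have sums (V : Type) (idx : V) (op : Monoid.com_law idx) (G : Cplx R -> V) :
  \big[op/idx]_(p <- sp) G (quad p u) = \big[op/idx]_(l <- s) G (u * l).
  by rewrite big_map; apply: eq_bigr => l _; rewrite /quad /= mul0r addr0.
have smalls l : l \in s -> modC (u * l) < 1.
  move=> ls; have := small u ud2 (l, 0); rewrite /quad /= mul0r addr0; apply.
  by rewrite in_cons map_f ?orbT.
have cvgz := zeta_series_cvg trB smalls.
split; first by apply/cvg_ex; eexists; exact: cvgz.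
have n0 : (n%:R : Cplx R) != 0.
  by rewrite pnatr_eq0 -lt0n; apply/card_gt0P; exists x0.
have d0 : 1 - (u * (b%:C)%C) ^+ 2 != 0.
  have := small u ud2 p2 (mem_head _ _); rewrite p2E => lt1.
  apply/eqP => /eqP; rewrite subr_eq0 exprMn mulrC -rmorphXn /= => /eqP d0.
  by move: lt1; rewrite -d0 modC1 ltxx.
have := det_arc_weight_sqr e_sym e_irr e_reg (c%:C)%C d0.
rewrite -/B detps -/n.
have -> : \det (1%:M - u *: B) = \prod_(l <- s) (1 - u * l).
  exact: det_scalar_sub_scale charB.
have -> : 1 - (u * (b%:C)%C) ^+ 2 = 1 - quad p2 u.
  by rewrite p2E exprMn mulrC -rmorphXn.
move=> detE; have := uniq12 u ud1.
rewrite !big_cat !big_nseq /= !(sums _ _ _ (fun z => 1 - z)).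
rewrite !(sums _ _ _ (fun z => LogC (1 - z))) !iter_mulr_1 !iter_addr_0 -!expr2.
move=> /(_ detE); rewrite p2E; set L0 := LogC (1 - _ * u ^+ 2).
set Ss := \sum_(l <- s) _; set Sp := \sum_(p <- ps) _ => logE.
rewrite /zeta_ab (cvg_lim _ cvgz) // -expCN opprK /powC -expCD; congr expC.
rewrite -/L0 -/Ss.
have -> : ((((q%:R - 1) / 2 : R)%:C)%C : Cplx R) = (q%:R - 1) / 2.
  by rewrite fmorph_div rmorphB /= !rmorph_nat.
have {}logE : (2 * n%:R) * L0 + (Ss + Ss) = (n%:R * q.+1%:R) * L0 + (Sp + Sp).
  by rewrite -!natrM !mulr_natl.
(* Clearing [2 n] reduces the claim to [logE]; the exponent arises as
   [(n (q + 1) - 2 n) / (2 n) = (q - 1) / 2]. *)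
apply: (mulfI n0); rewrite mulVKf // mulrDr mulVKf //.
have two0 : (2 : Cplx R) != 0 by rewrite pnatr_eq0.
apply: (mulfI two0).
rewrite mulr_natl mulr2n.
have -> : Ss + Ss = (n%:R * q.+1%:R) * L0 + (Sp + Sp) - (2 * n%:R) * L0.
  by rewrite -logE [X in X - _]addrC addrK.
by rewrite -natr1; field.
Qed.

End Zeta.

Theorem theorem7 (R : realType) (T : finType) (e : rel T) (x0 : T) (q : nat)
    (a b : R)
    (e_sym : symmetric e) (e_irr : irreflexive e)
    (e_conn : forall x y : T, connect e x y)
    (e_vt : vertex_transitive e)
    (e_reg : forall v : T, deg e v = q.+1)
    (a0 : 0 <= a) (a1 : a <= 1)
    (specP specL : seq (Cplx R))
    (HspecP : char_poly (Pmat R e) = \prod_(l <- specP) ('X - l%:P))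
    (HspecL : char_poly (Lapl R e) = \prod_(l <- specL) ('X - l%:P)) :
  let eta : R := (1 - q%:R) * a + b * (q.+1)%:R in
  let sigma : R := b * ((1 - q%:R) * a + b * q%:R) in
  exists delta : R, 0 < delta /\
  forall u : Cplx R, modC u < delta ->
    cvgn (series (zeta_term e a b x0 u)) /\
    (zeta_ab e a b x0 u)^-1 =
      powC (1 - ((b ^+ 2)%:C)%C * u ^+ 2) ((((q%:R - 1) / 2 : R)%:C)%C) *
      expC ((#|T|%:R)^-1 *
            \sum_(l <- specP) LogC ((1 + (sigma%:C)%C * u ^+ 2) - (eta%:C)%C * u * l)) /\
    (zeta_ab e a b x0 u)^-1 =
      powC (1 - ((b ^+ 2)%:C)%C * u ^+ 2) ((((q%:R - 1) / 2 : R)%:C)%C) *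
      expC ((#|T|%:R)^-1 *
            \sum_(l <- specL) LogC ((1 - (eta%:C)%C * u + (sigma%:C)%C * u ^+ 2)
                                    + (eta%:C)%C * u / (q.+1)%:R * l)).
Proof.
move=> eta sigma.
pose c : R := (2 / q.+1%:R - 1) * a.
have q0 : (q.+1%:R : R) != 0 by rewrite pnatr_eq0.
have etaE : eta = (c + b) * q.+1%:R.
  by rewrite /eta /c -natr1; field; rewrite natr1.
(* In this form [sigma] is the coefficient of [u ^+ 2] in the scalar part of the vertex determinant,
   as [bE] records. *)
have sigmaE : sigma = b * eta - b ^+ 2.
  by rewrite /sigma /eta -natr1; ring.
pose E : Cplx R := (eta%:C)%C; pose S : Cplx R := (sigma%:C)%C.
pose Q : Cplx R := q.+1%:R.
have Q0 : Q != 0 by rewrite pnatr_eq0.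
have QE : Q = ((q.+1%:R)%:C)%C by rewrite rmorph_nat.
have tE (u : Cplx R) : u * ((c%:C)%C + (b%:C)%C) = u * E / Q.
  rewrite -rmorphD -mulrA; congr (_ * _); apply: (mulIf Q0); rewrite divfK //.
  by rewrite QE -rmorphM -etaE.
have bE (u : Cplx R) : 1 - (u * (b%:C)%C) ^+ 2 +
    u * ((c%:C)%C + (b%:C)%C) * (u * (b%:C)%C) * Q = 1 + S * u ^+ 2.
  rewrite tE /S sigmaE rmorphB rmorphM rmorphXn /= -/E; field.
  by rewrite nat1r.
have [|dP dP0 HP] := @zeta_formula R T e x0 q a b e_sym e_irr e_vt e_reg
    [seq (E * l, - S) | l <- specP].
  move=> u; rewrite /= -/c -/Q bE tE big_map.
  have -> : (u * E / Q) *: adj_mx (Cplx R) e = (u * E) *: Pmat R e.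
    apply/matrixP => i j; rewrite !mxE e_reg -/Q.
    by case: ifP => _; rewrite ?mulr0 ?mulr1.
  rewrite (det_scalar_sub_scale _ _ HspecP); apply: eq_bigr => l _.
  by rewrite /quad /=; ring.
have [|dL dL0 HL] := @zeta_formula R T e x0 q a b e_sym e_irr e_vt e_reg
    [seq (E - E / Q * l, - S) | l <- specL].
  move=> u; rewrite /= -/c -/Q bE tE big_map.
  (* By regularity the adjacency matrix is [Q] minus the Laplacian; the scalar [Q] contributes the
     term [- E * u]. *)
  have -> : (1 + S * u ^+ 2)%:M - (u * E / Q) *: adj_mx (Cplx R) e =
      (1 - E * u + S * u ^+ 2)%:M - (- (E * u / Q)) *: Lapl R e.
    apply/matrixP => i j; rewrite !mxE e_reg -/Q.
    by case: (i == j); case: ifP => _; rewrite ?mulr1n ?mulr0n; field; rewrite nat1r.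
  rewrite (det_scalar_sub_scale _ _ HspecL); apply: eq_bigr => l _.
  by rewrite /quad /=; ring.
exists (Num.min dP dL); split; first by rewrite lt_min dP0.
move=> u; rewrite lt_min => /andP[uP uL].
have [cv ->] := HP u uP; have [_ zL] := HL u uL.
split=> //; split.
  rewrite big_map; congr (_ * expC (_ * _)); apply: eq_bigr => l _.
  by congr LogC; rewrite /quad /=; ring.
(* The earlier rewriting replaced the left side of both formulas; here the inverse zeta function is
   restored before its Laplacian form is used. *)
have [_ <-] := HP u uP; rewrite zL big_map; congr (_ * expC (_ * _)).
by apply: eq_bigr => l _; congr LogC; rewrite /quad /= -/E -/S -/Q; ring.
Qed.
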